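(* Let $(T,X)$ be an invertible semiflow such that $T$ is a connected topological semigroup and $X$ is a compact metrizable space with $1\le\dim X<\infty$. If $M$ is a $T$-minimal subset of $X$, then either $\dim M=0$ or $M$ is a Cantor-manifold.
   Context: A topological semigroup $T$ is a Hausdorff space with jointly continuous associative multiplication and identity $e$. A semiflow $(T,X)$ is a jointly continuous map $T\times X\to X$, $(t,x)\mapsto tx$, with $ex=x$ and $t(sx)=(ts)x$. It is invertible if each map $x\mapsto tx$ is a bijection of $X$. A subset $M\subseteq X$ is ($T$-)minimal if it is nonempty, closed, satisfies $tM\subseteq M$ for all $t\in T$, and contains no proper subset with these properties. $\dim$ is topological dimension (with $\dim\emptyset=-1$). A Cantor-manifold is a compact metrizable space $M$ of positive finite dimension $n$ such that $M$ is not disconnected by a subset of dimension $\le n-2$. *)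

(* Defs.v *)
From HB Require Import structures.
From mathcomp Require Import all_boot all_order all_algebra.
From mathcomp Require Import all_classical all_reals all_analysis.

Set Implicit Arguments.
Unset Strict Implicit.
Unset Printing Implicit Defensive.

Import Order.TTheory GRing.Theory Num.Theory.

Local Open Scope classical_set_scope.
Local Open Scope ring_scope.

HB.mixin Record Monoid_isTopSemigroup T & Monoid T & Topological T := {
  top_semigroup_hausdorff : hausdorff_space T ;
  mulg_continuous : continuous (fun p : T * T => (p.1 * p.2)%g)
}.

#[short(type="topSemigroupType")]
HB.structure Definition TopSemigroup :=
  { T of Monoid T & Topological T & Monoid_isTopSemigroup T }.

Record semiflow (T : topSemigroupType) (X : topologicalType) := Semiflow {
  semiflow_act :> T -> X -> X ;
  semiflow_continuous : continuous (fun p : T * X => semiflow_act p.1 p.2) ;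
  semiflow1 : forall x, semiflow_act 1%g x = x ;
  semiflowM : forall t s x,
    semiflow_act t (semiflow_act s x) = semiflow_act (t * s)%g x
}.

Section Semiflows.
Context {T : topSemigroupType} {X : topologicalType}.
Implicit Types (F : semiflow T X) (M : set X).

Definition invertible_flow F := forall t, bijective (F t).

Definition flow_invariant F M := forall t, F t @` M `<=` M.

Definition minimal_set F M :=
  [/\ M !=set0, closed M, flow_invariant F M &
    forall N, N !=set0 -> closed N -> flow_invariant F N -> N `<=` M -> N = M].

End Semiflows.

Definition metrizable (R : realType) (X : topologicalType) :=
  exists d : X -> X -> R,
    [/\ forall x y, d x y = 0 <-> x = y,
        forall x y, d x y = d y x,
        forall x y z, d x z <= d x y + d y z &
        forall x, nbhs x =
          filter_from [set e : R | 0 < e] (fun e => [set y | d x y < e])].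

Section Dimension.
Variable X : topologicalType.

Definition open_cover (I : Type) (U : I -> set X) :=
  (forall i, open (U i)) /\ \bigcup_i U i = [set: X].

Definition refines (I J : Type) (V : J -> set X) (U : I -> set X) :=
  forall j, exists i, V j `<=` U i.

Definition covdim_lt (k : nat) :=
  forall (m : nat) (U : 'I_m -> set X), open_cover U ->
  exists (p : nat) (V : 'I_p -> set X),
    [/\ open_cover V, refines V U &
        forall x, (#|[pred j | x \in V j]| <= k)%N].

(* Lebesgue covering dimension. A point lying in at most k members of the
   refinement corresponds to dimension at most k - 1, whence the shift; the
   empty space gets k = 0, i.e., dimension -1. *)
Definition covdim : \bar int :=
  if pselect (exists k, `[< covdim_lt k >]) is left h
  then ((ex_minn h)%:Z - 1)%:E else +oo%E.

Lemma covdim_ltP (k : nat) : reflect (covdim_lt k) (covdim < k%:Z%:E)%E.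
Proof.
rewrite /covdim; case: pselect => [h|h]; last first.
  rewrite ltNge leey; constructor => hk.
  by apply: h; exists k; apply/asboolP.
case: ex_minnP => n /asboolP nP nmin; rewrite lte_fin.
rewrite ltrBlDr -[1]/(1%:Z) -PoszD ltz_nat addn1 ltnS.
apply: (iffP idP) => [nk m U /nP[p [V [cV VU Vn]]]|/asboolP]; last exact: nmin.
by exists p, V; split=> // x; exact: leq_trans nk.
Qed.

End Dimension.

Lemma covdim_eqN1 (X : topologicalType) : covdim X = (-1)%:E <-> [set: X] = set0.
Proof.
have le0 : (covdim X < 0%:Z%:E)%E <-> [set: X] = set0.
  split=> [/covdim_ltP X0|X0].
    rewrite -subset0 => x _.
    have [|p [V [[_ Vt] _]]] := X0 1%N (fun=> [set: X]).
      split=> [i|]; first exact: openT.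
      by rewrite -subTset => y _; exists ord0.
    move=> /(_ x); rewrite leqn0 => /eqP/card0_eq V0.
    have [j _ Vjx] : (\bigcup_i V i) x by rewrite Vt.
    by have := V0 j; rewrite !inE; case/negP; apply: mem_set.
  apply/covdim_ltP => m U _; exists 0%N, (fun=> set0).
  split; [split=> [[]//|]|by case|move=> x].
    by rewrite X0 -subset0 => x [[]].
  by have : [set: X] x by []; rewrite X0.
split=> [dX|/le0]; first by apply/le0; rewrite dX.
by rewrite /covdim; case: pselect => // h; case: ex_minnP => -[|n].
Qed.

Definition cantor_manifold (R : realType) (M : topologicalType) :=
  [/\ compact [set: M], metrizable R M &
    exists n : nat, [/\ (0 < n)%N, covdim M = n%:Z%:E &
      forall D : set M, (covdim (set_type D) <= (n%:Z - 2)%:E)%E ->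
        connected (~` D)]].

(* Main.v *)
Require Import Defs.
From mathcomp Require Import all_boot all_order all_algebra.
From mathcomp Require Import all_classical all_reals all_analysis.
From mathcomp Require Import zify lra.

(* Let n = dim M >= 1 and fix a finite open cover U of M without refinement of
   order at most n (at most n members through a point). By compactness there
   is a minimal closed K in M on which U still has no such refinement. K cannot be split along a set of dimension
   at most n - 2: if K = K1 u K2 with K1, K2 proper, closed and
   dim (K1 n K2) <= n - 2, refinements of order n over K1 and K2 have a common
   refinement of order n - 1 near K1 n K2, and the prism triangulation joins
   the three without raising the order, contradicting the choice of K. If a set
   of dimension <= n - 2 disconnected M, a closed part of it would cut M into
   proper closed sets M1, M2. Each tK is homeomorphic to K, hence lies in
   exactly one of M1, M2; as T is connected it is the same one for all t, and
   the orbit of a point of K is not dense in M. *)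

Set Implicit Arguments.
Unset Strict Implicit.
Unset Printing Implicit Defensive.

Import Order.TTheory GRing.Theory Num.Theory numFieldNormedType.Exports.

Local Open Scope classical_set_scope.
Local Open Scope ring_scope.

(** * Covering dimension of subsets *)

(* The members of the refinement are open in the ambient space, but only their
   traces on [S] matter; members with empty trace are allowed. *)
Definition refinable (Y : topologicalType) (I : Type) (U : I -> set Y)
    (k : nat) (S : set Y) :=
  exists (J : finType) (V : J -> set Y),
    [/\ forall j, open (V j),
        S `<=` \bigcup_j V j,
        forall j, S `&` V j !=set0 -> exists i, S `&` V j `<=` U i &
        forall x, S x -> (#|[pred j | x \in V j]| <= k)%N].

(** Agrees with [covdim_lt] of the subspace by [covdim_lt_set_type]. Keeping all sets in one ambient
    space lets refinements over several subsets be glued. *)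
Definition covdim_lt_in (Y : topologicalType) (k : nat) (S : set Y) :=
  forall (m : nat) (U : 'I_m -> set Y), (forall i, open (U i)) ->
    S `<=` \bigcup_i U i -> refinable U k S.

Lemma covdim_lt_in_fin (Y : topologicalType) (k : nat) (S : set Y)
    (I : finType) (U : I -> set Y) :
  covdim_lt_in k S -> (forall i, open (U i)) -> S `<=` \bigcup_i U i ->
  refinable U k S.
Proof.
move=> dS oU SU.
have [|x /SU[i _ Uix]|J [V [oV SV VU Vk]]] := dS _ (U \o @enum_val I predT).
- by move=> i; exact: oU.
- by exists (enum_rank i) => //=; rewrite enum_rankK.
- by exists J, V; split=> // j /VU[i Ui]; exists (enum_val i).
Qed.

Lemma refinableW (Y : topologicalType) (I : Type) (U : I -> set Y) (k l : nat)
    (S S' : set Y) :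
  (k <= l)%N -> S' `<=` S -> refinable U k S -> refinable U l S'.
Proof.
move=> kl S'S [J [V [oV SV VU Vk]]]; exists J, V; split=> //.
- exact: subset_trans SV.
- move=> j [x [S'x Vjx]]; have [|i VUi] := VU j; first by exists x; split=> //; exact: S'S.
  by exists i => y [/S'S Sy Vjy]; exact: VUi.
- by move=> x /S'S/Vk; move/leq_trans; apply.
Qed.

(** The complement of [C], added under the index [None], completes a cover of [C] to one of [S]; no
    trace that meets [C] lies in it. *)
Lemma covdim_lt_in_closed (Y : topologicalType) (k : nat) (S C : set Y) :
  covdim_lt_in k S -> closed C -> C `<=` S -> covdim_lt_in k C.
Proof.
move=> dS cC CS m U oU CU.
have [|x Sx|J [V [oV SV VU Vk]]] :=
  @covdim_lt_in_fin _ _ _ (option 'I_m) (oapp U (~` C)) dS.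
- by case=> [i|] //=; exact: closed_openC.
- have [/CU[i _ Uix]|nCx] := pselect (C x); first by exists (Some i).
  by exists None.
exists J, V; split=> //.
- exact: subset_trans SV.
- move=> j [x [Cx Vjx]].
  have [|[i|] VUi] := VU j; first by exists x; split=> //; exact: CS.
  + by exists i => y [/CS Sy Vjy]; exact: VUi.
  + by have /(_ Cx) := VUi x (conj (CS _ Cx) Vjx).
- by move=> x /CS/Vk.
Qed.

Lemma covdim_lt_setT (Y : topologicalType) (k : nat) :
  covdim_lt Y k <-> covdim_lt_in k [set: Y].
Proof.
split=> [dY m U oU YU|dY m U [oU Ut]].
- have [|p [V [[oV Vt] VU Vk]]] := dY m U; first by split=> //; rewrite -subTset.
  exists 'I_p, V; split=> //; first by rewrite Vt.
  by move=> j _; have [i VUi] := VU j; exists i => x [_]; exact: VUi.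
- have [//|J [V [oV YV VU Vk]]] := dY m U oU; first by rewrite Ut.
  (* [refines] demands an index for empty members too; [i0] serves as their default, and the empty
     space takes the empty family. *)
  have [[x0 _]|Y0] := pselect ([set: Y] !=set0); last first.
    exists 0%N, (fun=> set0); split=> [|[]//|x]; last by case: Y0; exists x.
    by split=> [[]//|]; rewrite -subTset => x; case: Y0; exists x.
  have [i0 _ _] : (\bigcup_i U i) x0 by rewrite Ut.
  exists #|J|, (V \o @enum_val J predT); split.
  + split=> [j|]; first exact: oV.
    rewrite -subTset => x /YV[j _ Vjx].
    by exists (enum_rank j); rewrite //= enum_rankK.
  + move=> j; have [VN0|V0] := pselect (V (enum_val j) !=set0).
      have [|i] := VU (enum_val j); first by rewrite setTI.
      by rewrite setTI => ?; exists i.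
    by exists i0 => y Vy; exfalso; apply: V0; exists y.
  + move=> x; rewrite (leq_trans _ (Vk x I))//.
    rewrite -(fintype.card_image enum_val_inj); apply/subset_leq_card/fintype.subsetP.
    by move=> j /fintype.imageP[i]; rewrite !inE => Vx ->.
Qed.

Section SetType.
Context {Y : topologicalType} {S : set Y}.

Lemma open_set_typeP (A : set (set_type S)) :
  open A <-> exists G, open G /\ A = set_val @^-1` G.
Proof. by split=> [[G oG GA]|[G [oG ->]]]; exists G. Qed.

Lemma set_val_continuous : continuous (set_val : set_type S -> Y).
Proof. by apply/continuousP => G oG; apply/open_set_typeP; exists G. Qed.

Lemma open_set_type_ext (I : Type) (U : I -> set (set_type S)) :
  (forall i, open (U i)) ->
  exists G : I -> set Y, (forall i, open (G i)) /\
    U = (fun i => set_val @^-1` G i).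
Proof.
move=> oU; have /choice[G GU] : forall i, exists G, open G /\ U i = set_val @^-1` G.
  by move=> i; apply/open_set_typeP.
by exists G; split=> [i|]; [case: (GU i)|apply/funext => i; case: (GU i)].
Qed.

Lemma covdim_lt_set_type (k : nat) :
  covdim_lt (set_type S) k <-> covdim_lt_in k S.
Proof.
rewrite covdim_lt_setT; split=> [dS m U oU SU|dS m U].
- have [||J [V [oV SV VU Vk]]] := dS m (fun i => set_val @^-1` U i).
  + by move=> i; apply/open_set_typeP; exists (U i).
  + by move=> -[x xS] _; have [i _ Uix] := SU x (set_mem xS); exists i.
  have [G [oG GV]] := open_set_type_ext oV.
  exists J, G; split=> //.
  + move=> x Sx; have [//|j _] := SV (SigSub (mem_set Sx)).
    by rewrite GV; exists j.
  + move=> j [x [Sx Gjx]]; have [|i VUi] := VU j.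
      by exists (SigSub (mem_set Sx)); rewrite GV.
    exists i => y [Sy Gjy]; apply: (VUi (SigSub (mem_set Sy))).
    by rewrite GV.
  + move=> x Sx; rewrite (leq_trans _ (Vk (SigSub (mem_set Sx)) I))//.
    by apply/subset_leq_card/fintype.subsetP => j; rewrite !inE GV.
- move=> /open_set_type_ext[G [oG ->]] SG.
  have [//||J [V [oV SV VG Vk]]] := dS m G.
    by move=> x Sx; have [//|i _] := SG (SigSub (mem_set Sx)); exists i.
  exists J, (fun j => set_val @^-1` V j); split.
  + by move=> j; apply/open_set_typeP; exists (V j).
  + by move=> [x xS] _; have [j _ Vjx] := SV x (set_mem xS); exists j.
  + move=> j [[x xS] [_ Vx]].
    have [|i VGi] := VG j; first by exists x; split=> //; exact: set_mem.
    by exists i => -[y yS] [_ Vjy]; apply: VGi; split=> //; exact: set_mem.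
  + move=> [x xS] _; exact: (leq_trans _ (Vk x (set_mem xS))).
Qed.

End SetType.

(** * Swelling of relatively open sets *)

Section Swelling.
Context {R : realType} {Y : topologicalType} {d : Y -> Y -> R}.
Context (dmetric : [/\ forall x y, d x y = 0 <-> x = y,
  forall x y, d x y = d y x,
  forall x y z, d x z <= d x y + d y z &
  forall x, nbhs x =
    filter_from [set e : R | 0 < e] (fun e => [set y | d x y < e])]).

Let dxx x : d x x = 0. Proof. by case: dmetric => /(_ x x)[_ ->]. Qed.
Let dC x y : d x y = d y x. Proof. by case: dmetric. Qed.
Let dtri y x z : d x z <= d x y + d y z. Proof. by case: dmetric. Qed.
Let nbhsdP x A : nbhs x A <-> exists2 e : R, 0 < e & forall y, d x y < e -> A y.
Proof. by case: dmetric => _ _ _ ->. Qed.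

(* Union of balls centred in [S], of half the radius for which the ball meets
   [S] within [V]: for relatively open [V] it is an open set of the whole
   space with trace [V] on [S], and swelling creates no new intersections. *)
Definition swell (S V : set Y) : set Y :=
  [set x | exists y r, [/\ S y, 0 < r, forall z, S z -> d y z < r -> V z &
    d y x < r / 2]].

Lemma open_swell (S V : set Y) : open (swell S V).
Proof.
rewrite openE => x [y [r [Sy r0 SV yx]]]; apply/nbhsdP.
exists (r / 2 - d y x); first by rewrite subr_gt0.
move=> z xz; exists y, r; split=> //.
by apply: (le_lt_trans (dtri x _ _)); lra.
Qed.

Lemma sub_swell (S V : set Y) : open V -> S `&` V `<=` swell S V.
Proof.
rewrite openE => oV x [Sx /oV/nbhsdP[e e0 eV]].
exists x, e; split=> //; first by move=> z _ /eV.
by rewrite dxx divr_gt0.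
Qed.

(** Among the centres whose balls contain [x], the one of smallest radius works: its distance to a
    centre of radius [r] is less than half the sum of the two radii, hence less than [r]. *)
Lemma swell_bigcap (S : set Y) (J : finType) (P : pred J) (V : J -> set Y) x :
  (exists j, P j) -> (forall j, P j -> swell S (V j) x) ->
  exists2 y, S y & forall j, P j -> V j y.
Proof.
move=> [j0 Pj0] sVx.
have /choice[f fP] : forall j, exists p : Y * R, P j -> [/\ S p.1, 0 < p.2,
    forall z, S z -> d p.1 z < p.2 -> V j z & d p.1 x < p.2 / 2].
  move=> j; have [Pj|_] := boolP (P j); last by exists (x, 0).
  by have [y [r yr]] := sVx _ Pj; exists (y, r).
have [i Pi imin] := @arg_minP _ _ _ j0 P (fun j => (f j).2) Pj0.
have [Si ri _ ix] := fP _ Pi.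
exists (f i).1 => // j Pj; have [_ _ jV jx] := fP _ Pj.
apply: jV => //; have := imin _ Pj; have := dtri x (f j).1 (f i).1.
by rewrite (dC x); lra.
Qed.

Lemma swell_disjoint (S V W : set Y) :
  S `&` V `&` W = set0 -> swell S V `&` swell S W = set0.
Proof.
rewrite -!subset0 => SVW x [xV xW].
have [||y Sy VWy] := @swell_bigcap S bool predT (fun b => if b then V else W) x.
- by exists true.
- by case.
by apply: (SVW y); split; [split|]; [|exact: (VWy true)|exact: (VWy false)].
Qed.

End Swelling.

Section Refinable.
Context {R : realType} {Y : topologicalType}.
Context (Ymet : metrizable R Y).
Context {I : Type} {U : I -> set Y}.
Context (oU : forall i, open (U i)).

(** Each member is swollen and cut down to some [U i]. A point lying in several of the new sets
    yields, by [swell_bigcap], a point of [S] in all the corresponding members, so the bound [k]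
    extends from [S] to the whole space. *)
Lemma refinable_open (k : nat) (S : set Y) : refinable U k S ->
  exists (J : finType) (V : J -> set Y),
    [/\ forall j, open (V j), S `<=` \bigcup_j V j,
        forall j, V j !=set0 -> exists i, V j `<=` U i &
        forall x, (#|[pred j | x \in V j]| <= k)%N].
Proof.
have [d dmet] := Ymet.
move=> [J [V [oV SV VU Vk]]].
have /choice[G GP] : forall j, exists G, [/\ open G, S `&` V j `<=` G,
    G `<=` swell S (V j) (d := d) & G !=set0 -> exists i, G `<=` U i].
  move=> j; have [/VU[i SVU]|SV0] := pselect (S `&` V j !=set0).
    exists (swell S (V j) (d := d) `&` U i); split.
    - by apply: openI; [exact: open_swell|].
    - by move=> x SVx; split; [exact: sub_swell|exact: SVU].
    - exact: subIsetl.
    - by move=> _; exists i; exact: subIsetr.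
  exists set0; split; first exact: open0.
  - by move=> x SVx; apply: SV0; exists x.
  - by [].
  - by case.
exists J, G; split.
- by move=> j; case: (GP j).
- by move=> x Sx; have [j _ Vjx] := SV _ Sx; exists j => //; case: (GP j) => _ + _ _; apply.
- by move=> j; case: (GP j).
move=> x; have [[j0 Gx]|/forallNP G0] := pselect (exists j, G j x); last first.
  by rewrite eq_card0// => j; rewrite !inE; apply/negP; rewrite inE.
have [||y Sy Vy] := @swell_bigcap _ _ _ dmet S J [pred j | x \in G j] V x.
- by exists j0; rewrite !inE.
- by move=> j; rewrite !inE; case: (GP j) => _ _ + _; apply.
apply: leq_trans (Vk y Sy); apply/subset_leq_card/fintype.subsetP => j.
by rewrite !inE => Gjx; apply: Vy; exact: mem_set.
Qed.

End Refinable.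

(** * Interpolation between two open covers *)

(* Prism triangulation of the mapping cylinder of the simplicial map [f] from
   the nerve of [W] to the nerve of [V]: as the height [h] grows, the members
   [W w] are exchanged one at a time for the members [V (f w)]. *)
Section Prism.
Context {R : realType} {Y : topologicalType} {J I : finType}.
Context (W : J -> set Y) (V : I -> set Y) (f : J -> option I) (h : Y -> R).
Context (WV : forall w, W w `<=` oapp V set0 (f w)).

Let level (w : J) : R := (enum_rank w)%:R.

Let level_le (w : J) : level w + 1 <= #|J|%:R.
Proof. by rewrite /level natr1 ler_nat ltn_ord. Qed.

Definition prism_low (w : J) : set Y := W w `&` [set x | h x < level w + 1].

(** Above the top level [#|J|] all of [V v] is present, so that [W] has to cover only where [h] is
    at most [#|J|]. *)
Definition prism_high (v : I) : set Y :=
  (V v `&` [set x | #|J|%:R < h x]) `|`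
  \bigcup_(w in [set w | f w = Some v]) (W w `&` [set x | level w < h x]).

Lemma prism_high_sub v : prism_high v `<=` V v.
Proof. by move=> x [[]//|[w /= fw [/WV + _]]]; rewrite fw. Qed.

Lemma prism_cover x : (h x <= #|J|%:R -> (\bigcup_w W w) x) ->
  (\bigcup_v V v) x ->
  (\bigcup_w prism_low w) x \/ (\bigcup_v prism_high v) x.
Proof.
move=> hW [v _ Vvx]; have [hx|hx] := ltP #|J|%:R (h x).
  by right; exists v => //; left.
have [w _ Wx] := hW hx; have [hw|hw] := ltP (h x) (level w + 1).
  by left; exists w.
have := WV Wx; case fw: (f w) => [u|]//= Vux.
right; exists u => //; right; exists w => //; split=> //=.
by apply: lt_le_trans hw; rewrite ltrDl.
Qed.

(* Below the top level, [x] is counted twice only for the [w] whose level is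
   the integral part of [h x]. *)
Lemma prism_card (n : nat) x : (#|[pred w | x \in W w]| <= n)%N ->
  (#|[pred v | x \in V v]| <= n.+1)%N ->
  (#|[pred w | x \in prism_low w]| + #|[pred v | x \in prism_high v]| <= n.+1)%N.
Proof.
move=> Wn Vn; have [hx|hx] := ltP #|J|%:R (h x).
  rewrite eq_card0 ?add0n; last first.
    move=> w; rewrite !inE; apply/negP => /set_mem[_] /=.
    by rewrite ltNge; rewrite (le_trans (level_le w) (ltW hx)).
  apply: leq_trans Vn; apply/subset_leq_card/fintype.subsetP => v.
  by rewrite !inE; exact: prism_high_sub.
pose L := [pred w | x \in prism_low w].
pose H := [pred w | (x \in W w) && (level w < h x)].
(* Up to the top level, [x] enters [prism_high v] only through some [w] in [H] with
   [f w = Some v]. *)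
have leH : (#|[pred v | x \in prism_high v]| <= #|H|)%N.
  have SomeI : injective (@Some I) by move=> ? ? [].
  rewrite -(fintype.card_image SomeI).
  apply: leq_trans (leq_image_card f H); apply/subset_leq_card/fintype.subsetP.
  move=> _ /fintype.imageP[v + ->]; rewrite !inE.
  move=> [[_ /=]|[w /= fw [Wx wh]]]; first by rewrite ltNge hx.
  by apply/fintype.imageP; exists w; rewrite // inE wh andbT mem_set.
apply: leq_trans (_ : #|L| + #|H| <= _)%N; first by rewrite leq_add2l.
rewrite -cardUI -addn1 leq_add//.
  apply: leq_trans Wn; apply/subset_leq_card/fintype.subsetP => w.
  by rewrite !inE => /orP[/set_mem[]|/andP[/set_mem]].
apply/card_le1_eqP => v w.
rewrite !inE => /andP[/set_mem[_ /= v1] /andP[_ v2]] /andP[/set_mem[_ /= w1] /andP[_ w2]].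
apply/enum_rank_inj/val_inj/eqP; rewrite eqn_leq /=.
have lt_level (a b : nat) : a%:R < b%:R + 1 :> R -> (a <= b)%N.
  by rewrite natr1 ltr_nat ltnS.
by rewrite !lt_level//; [exact: lt_trans w1|exact: lt_trans v1].
Qed.

Context (oW : forall w, open (W w)) (oV : forall v, open (V v)).
Context (ch : continuous h).

Let open_lt (a : R) : open [set x | h x < a].
Proof. by apply: (open_comp (D := [set y | y < a])) => [x _|]; [exact: ch|exact: open_lt]. Qed.

Let open_gt (a : R) : open [set x | a < h x].
Proof. by apply: (open_comp (D := [set y | y > a])) => [x _|]; [exact: ch|exact: open_gt]. Qed.

Lemma open_prism_low w : open (prism_low w).
Proof. exact: openI. Qed.

Lemma open_prism_high v : open (prism_high v).
Proof.
by apply: openU; [exact: openI|apply: bigcup_open => w _; exact: openI].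
Qed.

End Prism.

(** * Refinability in compact metrizable spaces *)

Lemma metrizable_hausdorff (R : realType) (Y : topologicalType) :
  metrizable R Y -> hausdorff_space Y.
Proof.
move=> [d [d0 dC dtri dn]] x y xy; apply/d0/eqP; apply/negPn/negP => dxy.
have d0' : 0 < d x y.
  rewrite lt_neqAle eq_sym dxy /=; have := dtri x y x.
  by rewrite (d0 x x).2// -(dC x); lra.
have [||z [/= xz]] := xy [set z | d x z < d x y / 2] [set z | d y z < d x y / 2].
- by rewrite dn; exists (d x y / 2) => //=; rewrite divr_gt0.
- by rewrite dn; exists (d x y / 2) => //=; rewrite divr_gt0.
by have := dtri x z y; rewrite (dC z); lra.
Qed.

Section CompactMetrizable.
Context {R : realType} {Y : topologicalType}.
Context (Ymet : metrizable R Y) (Ycompact : compact [set: Y]).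

Let Yhaus : hausdorff_space Y := metrizable_hausdorff Ymet.

(** Two prisms over the same [W] lead to [V1] along [K1] and to [V2] along [K2]. The upper members
    of each are kept off the other closed set, so only one prism counts at a given point and
    [prism_card] bounds the order there. *)
Lemma refinable_setU (I : Type) (U : I -> set Y) (n : nat) (K1 K2 : set Y) :
  (forall i, open (U i)) -> closed K1 -> closed K2 ->
  covdim_lt_in n (K1 `&` K2) ->
  refinable U n.+1 K1 -> refinable U n.+1 K2 -> refinable U n.+1 (K1 `|` K2).
Proof.
move=> oU cK1 cK2 dK.
move=> /(refinable_open Ymet oU)[I1 [V1 [oV1 KV1 VU1 Vn1]]].
move=> /(refinable_open Ymet oU)[I2 [V2 [oV2 KV2 VU2 Vn2]]].
pose V12 (p : I1 * I2) := V1 p.1 `&` V2 p.2.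
have oV12 p : open (V12 p) by exact: openI.
have [|J [W [oW KW WV Wn]]] := refinable_open Ymet oV12 (covdim_lt_in_fin dK oV12 _).
  move=> x [/KV1[i1 _ V1x] /KV2[i2 _ V2x]].
  by exists (i1, i2).
have /choice[f WVf] : forall w, exists p, W w `<=` oapp V12 set0 p.
  move=> w; have [/WV[p Wp]|W0] := pselect (W w !=set0); first by exists (Some p).
  by exists None => x Wx; apply: W0; exists x.
(* A single parent in [V12] gives both simplicial maps; the value [None] forces [W w] to be
   empty. *)
pose f1 w := omap fst (f w); pose f2 w := omap snd (f w).
have WV1 w : W w `<=` oapp V1 set0 (f1 w).
  by move=> x /WVf; rewrite /f1; case: (f w) => //= p [].
have WV2 w : W w `<=` oapp V2 set0 (f2 w).
  by move=> x /WVf; rewrite /f2; case: (f w) => //= p [].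
(* [h] is 0 on the intersection of [K1] and [K2], where the low members suffice, and exceeds the top
   level off the union of [W], where only [V1] and [V2] remain. *)
have [h [ch h0 h1 _]] : exists h : Y -> R, [/\ continuous h,
    [set h x | x in K1 `&` K2] `<=` [set 0],
    [set h x | x in ~` \bigcup_w W w] `<=` [set #|J|%:R + 1] &
    range h `<=` `[0, #|J|%:R + 1]].
  apply: urysohn_ext_itv.
  - exact: compact_normal.
  - exact: closedI.
  - by apply: open_closedC; exact: bigcup_open.
  - by rewrite -subset0 => x [/KW].
  - by rewrite ltr_wpDl.
have hW x : h x <= #|J|%:R -> (\bigcup_w W w) x.
  move=> hx; apply: contrapT => nWx.
  have /= hx1 : [set #|J|%:R + 1] (h x) by apply: h1; exists x.
  by move: hx; rewrite hx1 gerDl ler10.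
pose B1 v := prism_high W V1 f1 h v `&` ~` K2.
pose B2 v := prism_high W V2 f2 h v `&` ~` K1.
pose G (j : J + (I1 + I2)) := match j with
  inl w => prism_low W h w | inr (inl v) => B1 v | inr (inr v) => B2 v end.
have lowW w x : prism_low W h w x -> W w x by case.
exists (J + (I1 + I2))%type, G; split.
- move=> [w|[v|v]] /=; first exact: open_prism_low.
  + by apply: openI; [exact: open_prism_high|exact: closed_openC].
  + by apply: openI; [exact: open_prism_high|exact: closed_openC].
- move=> x; have [K1x _|nK1x [//|K2x]] := pselect (K1 x).
    have [K2x|nK2x] := pselect (K2 x).
      have [w _ Wx] := KW x (conj K1x K2x).
      exists (inl w) => //; split=> //=.
      have /= -> : [set 0] (h x) by apply: h0; exists x.
      by rewrite ltr_wpDl.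
    have [[w _ ?]|[v _ ?]] := prism_cover WV1 (@hW x) (KV1 x K1x).
    + by exists (inl w).
    + by exists (inr (inl v)).
  have [[w _ ?]|[v _ ?]] := prism_cover WV2 (@hW x) (KV2 x K2x).
  + by exists (inl w).
  + by exists (inr (inr v)).
- move=> [w|[v|v]] [x [_ Gx]].
  + have := WV1 w; have := lowW _ _ Gx => /[swap] /[apply].
    case fw : (f1 w) => [v|]//= V1x; have [|i VUi] := VU1 v; first by exists x.
    by exists i => y [_ /lowW/WV1]; rewrite fw => /VUi.
  + have [|i VUi] := VU1 v; first by exists x; exact: (prism_high_sub WV1 Gx.1).
    by exists i => y [_ [/(prism_high_sub WV1)/VUi]].
  + have [|i VUi] := VU2 v; first by exists x; exact: (prism_high_sub WV2 Gx.1).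
    by exists i => y [_ [/(prism_high_sub WV2)/VUi]].
- move=> x Kx.
  rewrite -sum1_card big_sumType/= big_sumType/= !sum1_card.
  set a := #|_|; set b := #|_|; set c := #|_|.
  have b0 : K2 x -> b = 0%N.
    by move=> K2x; apply: eq_card0 => v; rewrite !inE; apply/negP => /set_mem[].
  have c0 : K1 x -> c = 0%N.
    by move=> K1x; apply: eq_card0 => v; rewrite !inE; apply/negP => /set_mem[].
  have leb : (a + b <= n.+1)%N.
    apply: leq_trans (prism_card h WV1 (Wn x) (Vn1 x)); apply: leq_add;
      apply/subset_leq_card/fintype.subsetP => v //; rewrite !inE => -[]//.
  have lec : (a + c <= n.+1)%N.
    apply: leq_trans (prism_card h WV2 (Wn x) (Vn2 x)); apply: leq_add;
      apply/subset_leq_card/fintype.subsetP => v //; rewrite !inE => -[]//.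
  by case: Kx => [/c0 ->|/b0 ->]; rewrite ?addn0 ?add0n.
Qed.

(** By compactness [g] is a closed embedding, so the preimage of [S] is homeomorphic to the closed
    part of [S] inside the range. The complement of the image of the complement of [U i] is an open
    set with preimage [U i]. *)
Lemma covdim_lt_in_preimage (g : Y -> Y) (k : nat) (S : set Y) :
  continuous g -> injective g -> closed S ->
  covdim_lt_in k S -> covdim_lt_in k (g @^-1` S).
Proof.
move=> cg ig cS dS m U oU SU.
have cgim A : closed A -> closed (g @` A).
  move=> cA; apply: compact_closed => //; apply: continuous_compact.
    exact: continuous_subspaceT.
  exact: subclosed_compact Ycompact _.
have gU i x : (~` (g @` ~` U i)) (g x) <-> U i x.
  split=> [nUx|Uix [y nUy /ig yx]]; last by apply: nUy; rewrite yx.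
  by apply: contrapT => nUix; apply: nUx; exists x.
have dSg : covdim_lt_in k (S `&` range g).
  apply: covdim_lt_in_closed dS _ _; last exact: subIsetl.
  by apply: closedI => //; apply: cgim; exact: closedT.
have [||J [V [oV SV VU Vk]]] := dSg m (fun i => ~` (g @` ~` U i)).
- by move=> i; apply/closed_openC/cgim/open_closedC.
- move=> y [Sy [x _ xy]]; move: Sy; rewrite -xy => /SU[i _ Uix].
  by exists i => //; exact/gU.
exists J, (fun j => g @^-1` V j); split.
- by move=> j; apply: open_comp => // x _; exact: cg.
- by move=> x Sx; have [|j _ Vjx] := SV (g x); [split=> //; exists x|exists j].
- move=> j [x [Sx Vx]]; have [|i VUi] := VU j.
    by exists (g x); split=> //; split=> //; exists x.
  by exists i => y [Sy Vy]; apply/gU/VUi; split=> //; split=> //; exists y.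
- move=> x Sx; apply: leq_trans (Vk (g x) _); last by split=> //; exists x.
  by apply/subset_leq_card/fintype.subsetP => j; rewrite !inE.
Qed.

(** Zorn's lemma, applied to the open complements. An open refinement over the intersection of a
    chain of closed sets already covers one member of the chain, by compactness. *)
Lemma minimal_nonrefinable (I : Type) (U : I -> set Y) (k : nat) :
  (forall i, open (U i)) -> ~ refinable U k [set: Y] ->
  exists K, [/\ closed K, ~ refinable U k K &
    forall C, closed C -> C `<=` K -> ~ (K `<=` C) -> refinable U k C].
Proof.
move=> oU nU.
have [|G [[oO nUO] Omax]] :=
    @Zorn_bigcup Y [set G | open G /\ ~ refinable U k (~` G)].
  move=> F FP Ftot; split; first by apply: bigcup_open => G /FP[].
  move=> /(refinable_open Ymet oU)[J [V [oV FV VU Vk]]].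
  (* The union of the empty chain is empty, and its complement is the whole space. *)
  have [F0|/nonemptyPn F0] := pselect (F !=set0); last first.
    apply: nU; exists J, V; split=> //.
    - by move: FV; rewrite F0 bigcup_set0 setC0.
    - by move=> j; rewrite setTI => /VU.
  pose C := ~` \bigcup_j V j.
  have cC : closed C by apply: open_closedC; exact: bigcup_open.
  have [[G FG GV]|nFG] := pselect (exists2 G, F G & ~` G `&` C = set0).
    have [_] := FP _ FG; apply; exists J, V; split=> //.
    - move=> x Gx; apply: contrapT => nVx.
      by have : (~` G `&` C) x by []; rewrite GV.
    - by move=> j [y [_ Vy]]; have [|i VUi] := VU j; [exists y|exists i => z [_ /VUi]].
  (* If [V] covers none of the closed sets of the chain, their parts outside [V] form a filter base;
     a cluster point lies in all of them, against [FV]. *)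
  pose FF := filter_from F (fun G => ~` G `&` C).
  have FFilter : ProperFilter FF.
    apply: filter_from_proper; last first.
      by move=> G FG; apply/set0P/eqP => OC; apply: nFG; exists G.
    apply: filter_from_filter => // G1 G2 F1 F2.
    have [G12|G21] := Ftot _ _ F1 F2.
      by exists G2 => // x [nO2 Cx]; split; split=> // /G12.
    by exists G1 => // x [nO1 Cx]; split; split=> // /G21.
  have [|z [_ clz]] := Ycompact FFilter; first by have [G FG] := F0; exists G.
  have zF G : F G -> (~` G `&` C) z.
    move=> FG; have cO : closed (~` G `&` C).
      by apply: closedI => //; apply: open_closedC; case: (FP _ FG).
    by apply: cO => B Bz; apply: clz => //; exists G.
  have [G FG] := F0; have [_ Cz] := zF _ FG.
  by apply: Cz; apply: FV => -[G' FG' G'z]; have [] := zF _ FG'.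
exists (~` G); split=> //; first exact: open_closedC.
move=> C cC CO nOC; apply: contrapT => nUC.
apply: (Omax (~` C)); last by rewrite /= setCK; split=> //; exact: closed_openC.
split; first by move=> x Ox /CO.
by move=> CO'; apply: nOC => x nOx; apply: contrapT => /CO'.
Qed.

End CompactMetrizable.

(** * Separation and strong connectedness *)

(** The two pieces of a separation of [A] are the traces of [C] and of the complement of [C']. Their
    swellings are disjoint, so the complements of these are closed sets that cover [Y] and meet only
    off [A]. *)
Lemma nonconnected_closed_cover (R : realType) (Y : topologicalType) (A : set Y) :
  metrizable R Y -> ~ connected A ->
  exists M1 M2 : set Y, [/\ closed M1, closed M2, M1 `|` M2 = [set: Y],
    M1 `&` M2 `<=` ~` A & ~` M1 !=set0 /\ ~` M2 !=set0].
Proof.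
move=> [d dmet] /existsNP[B /not_implyP[[b Bb]]].
move=> /not_implyP[[C oC BC]] /not_implyP[[C' cC' BC']] BA.
have oC'' : open (~` C') by exact: closed_openC.
have [a [Aa nBa]] : exists a, A a /\ ~ B a.
  apply: contrapT => /forallNP AB; apply: BA; apply/seteqP; split.
    by rewrite BC; exact: subIsetl.
  by move=> x Ax; apply: contrapT => nBx; apply: (AB x).
have disj : swell A C (d := d) `&` swell A (~` C') (d := d) = set0.
  apply: swell_disjoint => //; rewrite -BC -subset0 => x [].
  by rewrite BC' => -[].
exists (~` swell A (~` C') (d := d)), (~` swell A C (d := d)); split.
- by apply: open_closedC; exact: open_swell.
- by apply: open_closedC; exact: open_swell.
- by rewrite -setCI setIC disj setC0.
- move=> x [nC' nC] Ax; have [C'x|nC'x] := pselect (C' x).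
    have : B x by rewrite BC'.
    by rewrite BC => -[_ Cx]; apply: nC; exact: sub_swell.
  by apply: nC'; exact: sub_swell.
- rewrite !setCK; split.
    exists a; apply: sub_swell => //; split=> // C'a.
    by apply: nBa; rewrite BC'.
  by exists b; apply: sub_swell => //; rewrite -BC.
Qed.

Section StronglyConnected.
Context {R : realType} {Y : topologicalType}.
Context (Ymet : metrizable R Y) (Ycompact : compact [set: Y]).

(* The analogue for covers of the n-dimensional Cantor-manifold that Hurewicz
   and Wallman find inside an n-dimensional compactum. *)
Lemma strongly_connected_subset (n : nat) :
  ~ covdim_lt_in n.+1 [set: Y] ->
  exists K : set Y, [/\ closed K, K !=set0 &
    forall M1 M2, closed M1 -> closed M2 -> K `<=` M1 `|` M2 ->
      covdim_lt_in n (K `&` (M1 `&` M2)) ->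
      (K `<=` M1 \/ K `<=` M2) /\ ~ (K `<=` M1 `&` M2)].
Proof.
move=> /existsNP[m] /existsNP[U] /not_implyP[oU] /not_implyP[YU nU].
have [K [cK nK Kmin]] := minimal_nonrefinable Ymet Ycompact oU nU.
exists K; split=> //.
  apply: contrapT => /nonemptyPn K0; apply: nK; rewrite K0.
  by exists 'I_0, (fun=> set0); split=> [[]|x []|[]|x []].
move=> M1 M2 cM1 cM2 KM dK; split.
  (* Otherwise both traces on [K] are proper closed subsets, refinable by minimality, and
     [refinable_setU] makes [K] refinable. *)
  apply: contrapT => /not_orP[nKM1 nKM2]; apply: nK.
  rewrite (_ : K = (K `&` M1) `|` (K `&` M2)); last first.
    by rewrite -setIUr; apply/esym/setIidPl.
  have refC C : closed C -> ~ K `<=` C -> refinable U n.+1 (K `&` C).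
    move=> cC nKC; apply: Kmin; [exact: closedI|exact: subIsetl|].
    by rewrite subsetI => -[].
  apply: (refinable_setU Ymet) => //; [exact: closedI|exact: closedI| |exact: refC|exact: refC].
  by rewrite -setIIr.
(* Then [K] itself would have a refinement of order at most [n], hence at most [n.+1]. *)
move=> /setIidPl KM12; apply: nK; rewrite KM12 in dK.
have : refinable U n K by apply: dK => // x _; exact: YU.
exact: refinableW.
Qed.

End StronglyConnected.

(** * Subspaces and connectedness *)

Lemma compact_set_type (X : topologicalType) (S : set X) :
  compact S -> compact [set: set_type S].
Proof.
move=> cS G PG _; have GS : (set_val @ G) S.
  by apply: (@filterS _ G _ [set: set_type S]) => [[y yS] _|]; [exact: set_mem|exact: filterT].
have [x [Sx clx]] := cS (set_val @ G) _ GS.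
exists (SigSub (mem_set Sx)); split=> // A B GA.
rewrite nbhsE => -[_ [[C oC <-] Cx] CB].
have GA' : (set_val @ G) (set_val @` A) 
    by apply: (@filterS _ G _ A) => // y Ay; exists y.
have [_ [[[y yS] Ay <-] Cy]] := clx _ C GA' (open_nbhs_nbhs (conj oC Cx)).
by exists (SigSub yS); split=> //; exact: CB.
Qed.

Lemma metrizable_set_type (R : realType) (X : topologicalType) (S : set X) :
  metrizable R X -> metrizable R (set_type S).
Proof.
move=> [d [d0 dC dtri dn]].
exists (fun x y => d (set_val x) (set_val y)); split=> //.
  by move=> x y; rewrite d0; split=> [/val_inj|->].
move=> x; apply/seteqP; split=> A.
  rewrite nbhsE => -[_ [[C oC <-] Cx] CA].
  have : nbhs (set_val x) C by exact: open_nbhs_nbhs.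
  by rewrite dn => -[e e0 eC]; exists e => // y /eC/CA.
move=> [e e0 eA]; have : nbhs (set_val x) [set y | d (set_val x) y < e].
  by rewrite dn; exists e.
by move=> /(@set_val_continuous X S x) xA; apply: (@filterS _ _ (nbhs_filter x) _ _ _ xA) => y; exact: eA.
Qed.

Lemma continuous_to_set_type (Z X : topologicalType) (S : set X)
    (g : Z -> set_type S) :
  continuous (set_val \o g) -> continuous g.
Proof.
by move=> cg; apply/continuousP => _ [C oC <-]; move/continuousP: cg; apply.
Qed.

Lemma connected_closed_cover (T : topologicalType) (A B : set T) :
  connected [set: T] -> closed A -> closed B ->
  A `|` B = [set: T] -> A `&` B = set0 -> A = [set: T] \/ B = [set: T].
Proof.
move=> cT cA cB ABT AB0; have [A0|/nonemptyPn A0] := pselect (A !=set0); last first.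
  by right; rewrite -ABT A0 set0U.
left; apply: cT => //; last by exists A; rewrite ?setTI.
exists (~` B); first exact: closed_openC.
rewrite setTI; apply/seteqP; split=> [x Ax Bx|x nBx].
  by have : (A `&` B) x by []; rewrite AB0.
by have [] : (A `|` B) x by rewrite ABT.
Qed.

(** * Semiflows and dense orbits *)

Section SemiflowTheory.
Context {T : topSemigroupType} {X : topologicalType} (F : semiflow T X).

Lemma semiflow_continuousr t : continuous (F t).
Proof.
move=> x; apply: (@continuous_comp _ _ _ (fun x => (t, x)) (fun p => F p.1 p.2)).
  by apply: cvg_pair => //=; exact: cvg_cst.
exact: semiflow_continuous.
Qed.

Lemma semiflow_continuousl x : continuous (F ^~ x).
Proof.
move=> t; apply: (@continuous_comp _ _ _ (fun t => (t, x)) (fun p => F p.1 p.2)).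
  by apply: cvg_pair => //=; exact: cvg_cst.
exact: semiflow_continuous.
Qed.

(** The orbit closure contains [x], is closed and invariant, and lies in [M]; minimality does the
    rest. *)
Lemma minimal_orbit_dense (M : set X) x :
  minimal_set F M -> M x -> closure (range (F ^~ x)) = M.
Proof.
move=> [_ cM invM minM] Mx; apply: minM.
- by exists x; apply: subset_closure; exists 1%g => //; exact: semiflow1.
- exact: closed_closure.
- move=> t _ [y cly <-] B /semiflow_continuousr/cly[_ [[s _ <-] Bs]].
  by exists (F (t * s)%g x); split; [exists (t * s)%g|rewrite -semiflowM].
- rewrite [X in _ `<=` X]((closure_id M).1 cM); apply: closure_subset.
  by move=> _ [t _ <-]; apply: (invM t); exists x.
Qed.

End SemiflowTheory.

(** * Minimal sets as Cantor-manifolds *)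

Lemma covdim_eq_nat (X : topologicalType) (n : nat) :
  covdim_lt X n.+1 -> ~ covdim_lt X n -> covdim X = n%:Z%:E.
Proof.
move=> X1 Xn; rewrite /covdim; case: pselect => [h|h]; last first.
  by case: h; exists n.+1; exact/asboolP.
case: ex_minnP => m /asboolP Xm mmin.
have /eqP -> : m == n.+1; last by rewrite -addn1 PoszD addrK.
rewrite eqn_leq mmin; last exact/asboolP.
rewrite ltnNge; apply/negP => mn; apply: Xn; apply/covdim_ltP.
apply: lt_le_trans (_ : m%:Z%:E <= _)%E; first exact/covdim_ltP.
by rewrite lee_fin lez_nat.
Qed.

Theorem proposition1p28 (R : realType) (T : topSemigroupType)
    (X : topologicalType) (F : semiflow T X) (M : set X) :
  invertible_flow F -> connected [set: T] ->
  compact [set: X] -> metrizable R X ->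
  (1%:E <= covdim X)%E -> (covdim X < +oo)%E ->
  minimal_set F M ->
  covdim (set_type M) = 0%:E \/ cantor_manifold R (set_type M).
Proof.
move=> Finv Tconn Xcompact Xmet _ Xfin Mmin.
have [M0 cM invM _] := Mmin.
have Mcompact : compact [set: set_type M].
  by apply: compact_set_type; exact: subclosed_compact cM Xcompact _.
have Mmet : metrizable R (set_type M) by exact: metrizable_set_type.
have Mfin : exists k, `[< covdim_lt (set_type M) k >].
  move: Xfin; rewrite /covdim; case: pselect => [[k /asboolP Xk] _|_]; last by rewrite ltxx.
  exists k; apply/asboolP/covdim_lt_set_type.
  exact: covdim_lt_in_closed ((covdim_lt_setT _ _).1 Xk) cM _.
have [k /asboolP Mk kmin] := ex_minnP Mfin.
have nMk l : (l < k)%N -> ~ covdim_lt (set_type M) l.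
  by move=> lk Ml; move: lk; rewrite ltnNge kmin//; exact/asboolP.
(* Since [k] is one more than the dimension, [k = 0] would make [M] empty, [k = 1] gives dimension
   0, and otherwise the dimension is [n.+1]. *)
case: k Mk nMk {kmin} => [|[|n]] Mk nMk.
- have [x Mx] := M0.
  have : covdim (set_type M) = (-1)%:E.
    rewrite /covdim; case: pselect => [h|[]//].
    by case: ex_minnP => m _ /(_ 0%N (asboolT Mk)); rewrite leqn0 => /eqP ->.
  move/covdim_eqN1 => M00.
  by have : [set: set_type M] (SigSub (mem_set Mx)) by []; rewrite M00.
- by left; apply: covdim_eq_nat => //; exact: nMk.
right; split=> //; exists n.+1; split=> //; first by apply: covdim_eq_nat => //; exact: nMk.
move=> D dD.
(* The bound [n.+1 - 2] on the dimension of [D] means order at most [n]. *)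
have {}dD : covdim_lt_in n D.
  apply/covdim_lt_set_type/covdim_ltP; apply: le_lt_trans dD _.
  by rewrite lte_fin -addn2; lia.
apply: contrapT => /(nonconnected_closed_cover Mmet)[M1 [M2 [cM1 cM2 M12 MD [M1n M2n]]]].
rewrite setCK in MD.
have nMn : ~ covdim_lt_in n.+1 [set: set_type M].
  by move=> /covdim_lt_setT; exact: nMk.
have [K [cK K0 Kconn]] := strongly_connected_subset Mmet Mcompact nMn.
(* [F t] as a self-map of the subspace [M], by invariance. *)
pose g t (y : set_type M) : set_type M :=
  SigSub (mem_set (invM t _ (ex_intro2 _ _ _ (set_valP y) erefl))).
have gE t y : set_val (g t y) = F t (set_val y) by [].
have gr t : continuous (g t).
  apply: continuous_to_set_type => y.
  apply: (@continuous_comp _ _ _ set_val (F t)); first exact: set_val_continuous.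
  exact: semiflow_continuousr.
have gl y : continuous (g ^~ y).
  by apply: continuous_to_set_type; exact: semiflow_continuousl.
have ginj t : injective (g t).
  move=> y z /(congr1 set_val); rewrite !gE => /(bij_inj (Finv t)).
  exact: val_inj.
have gpre C t : closed C -> closed (g t @^-1` C).
  by move=> cC; apply: closed_comp => // y _; exact: gr.
(* the whole orbit of a point of [K] would avoid the nonempty open set [~` C] *)
have orbit C : closed C -> ~` C !=set0 -> ~ (forall t, K `<=` g t @^-1` C).
  move=> cC [y nCy] KC; have [x Kx] := K0.
  have [G [oG CG]] := (open_set_typeP _).1 (closed_openC cC).
  have Gy : G (set_val y) by have : (~` C) y by []; rewrite CG.
  have := minimal_orbit_dense Mmin (set_valP x).
  move=> /seteqP[_ /(_ _ (set_valP y))].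
  move=> /(_ G (open_nbhs_nbhs (conj oG Gy)))[_ [[t _ <-] Gtx]].
  have nCx : (~` C) (g t x) by rewrite CG.
  exact: nCx (KC t x Kx).
(* For each [y] in [K] the condition on [t] is closed, by continuity of the orbit map; the set is
   the intersection of these conditions. *)
have closedK C : closed C -> closed [set t | K `<=` g t @^-1` C].
  move=> cC; rewrite (_ : [set t | _] = \bigcap_(y in K) ((g ^~ y) @^-1` C)).
    by apply: closed_bigI => y _; apply: closed_comp => // t _; exact: gl.
  by apply/seteqP; split=> t tK y; exact: tK.
(* Instead of moving [K] by [g t], the sets [M1] and [M2] are pulled back. Their intersection is a
   closed part of [D], and its preimage under the embedding [g t] is again of small dimension. *)
have dich t : (K `<=` g t @^-1` M1 \/ K `<=` g t @^-1` M2) /\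
    ~ (K `<=` g t @^-1` M1 `&` g t @^-1` M2).
  apply: Kconn; [exact: gpre|exact: gpre|by rewrite -preimage_setU M12|].
  rewrite -preimage_setI.
  have cM12 : closed (M1 `&` M2) by exact: closedI.
  apply: (@covdim_lt_in_closed _ _ (g t @^-1` (M1 `&` M2))); last exact: subIsetr.
    apply: (covdim_lt_in_preimage Mmet) => //.
    exact: covdim_lt_in_closed dD cM12 MD.
  by apply: closedI => //; exact: gpre.
(* The [t] that send [K] into [M1] and those that send it into [M2] form disjoint closed sets
   covering [T], so one of them is all of [T]. *)
have [||/seteqP[_ TM]|/seteqP[_ TM]] :=
    connected_closed_cover Tconn (closedK _ cM1) (closedK _ cM2).
- by apply/seteqP; split=> // t _; case: (dich t) => -[]; [left|right].
- apply/seteqP; split=> // t [KM1 KM2]; case: (dich t) => _; apply.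
  by move=> y Ky; split; [exact: KM1|exact: KM2].
- by apply: (orbit _ cM1 M1n) => t; exact: TM.
- by apply: (orbit _ cM2 M2n) => t; exact: TM.
Qed.
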